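(* Let $E$ be an orthocomplete homogeneous effect algebra. Then every block of $E$ is a lattice.
   Context: An effect algebra is a partial algebra $(E;\oplus,0,1)$ with $0\neq 1$ and a partial binary operation $\oplus$ such that for all $x,y,z\in E$: (1) $x\oplus y=y\oplus x$ if $x\oplus y$ is defined; (2) $(x\oplus y)\oplus z=x\oplus(y\oplus z)$ if one side is defined; (3) for every $x$ there is a unique $y$ (denoted $x'$) with $x\oplus y=1$; (4) if $1\oplus x$ is defined then $x=0$. One writes $x\le y$ and $y\ominus x=z$ iff $x\oplus z$ is defined and equals $y$; $\le$ is a partial order. A sub-effect algebra of $E$ is a subset $Q\subseteq E$ with $1\in Q$ such that whenever $x\oplus y=z$ in $E$ and two of $x,y,z$ lie in $Q$, all three lie in $Q$; it is an effect algebra with the inherited operation. $E$ satisfies the Riesz decomposition property if $u\le v_1\oplus v_2$ implies $u=u_1\oplus u_2$ for some $u_1\le v_1$, $u_2\le v_2$. $E$ is homogeneous if $u\le v_1\oplus v_2\le u'$ implies $u=u_1\oplus u_2$ for some $u_1\le v_1$, $u_2\le v_2$. A block of a homogeneous effect algebra $E$ is a maximal sub-effect algebra of $E$ with the Riesz decomposition property. A system $G=(x_\kappa)_{\kappa\in H}$ of not necessarily different elements of $E$ is orthogonal if for every finite subsystem $K$ of $G$ the sum $\bigoplus K$ exists (with $\bigoplus\emptyset=0$); it is orthosummable if the supremum $\bigvee\{\bigoplus K\mid K\subseteq G\text{ finite}\}$ exists in $E$. $E$ is orthocomplete if every orthogonal system in $E$ is orthosummable. *)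

(* Defs.v *)
From HB Require Import structures.
From mathcomp Require Import all_boot all_order.
From mathcomp Require Import finmap.
From mathcomp Require Import boolp classical_sets.

Set Implicit Arguments.
Unset Strict Implicit.
Unset Printing Implicit Defensive.

Import Order.TTheory.

Local Open Scope classical_set_scope.
Local Open Scope order_scope.

(* The partial operation takes values in option; [oplus x y = None] means that
   the sum is undefined. The equations [oplusC] and [oplusA] are between
   options: if one side is defined then so is the other, with the same value.
   The complement is uniquely determined by [oplus_complP]. *)
Record effectAlgebra := EffectAlgebra {
  ea_sort :> Type;
  oplus : ea_sort -> ea_sort -> option ea_sort;
  ezero : ea_sort;
  eone : ea_sort;
  compl : ea_sort -> ea_sort;
  ezero_neq_eone : ezero <> eone;
  oplusC : forall x y, oplus x y = oplus y x;
  oplusA : forall x y z,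
    obind (fun s => oplus s z) (oplus x y) =
    obind (fun s => oplus x s) (oplus y z);
  oplus_complP : forall x y, oplus x y = Some eone <-> y = compl x;
  oplus_eone : forall x, isSome (oplus eone x) -> x = ezero
}.

Arguments oplus {e} x y.
Arguments ezero {e}.
Arguments eone {e}.
Arguments compl {e} x.

Section Basics.
Variable E : effectAlgebra.
Implicit Types x y z s t r : E.

Lemma oplus_assocr x y z s r :
  oplus x y = Some s -> oplus s z = Some r ->
  exists2 t, oplus y z = Some t & oplus x t = Some r.
Proof.
move=> xy sz; have := oplusA x y z; rewrite xy /= sz.
by case: (oplus y z) => //= t xt; exists t.
Qed.

Lemma compl_eone : compl eone = ezero :> E.
Proof.
apply: oplus_eone.
by have /oplus_complP -> : compl eone = compl eone :> E by [].
Qed.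

Lemma oplus_compl x : oplus x (compl x) = Some eone.
Proof. by apply/oplus_complP. Qed.

Lemma oplus0 x : oplus x ezero = Some x.
Proof.
have := oplus_compl x; rewrite oplusC => x'x.
have : oplus eone ezero = Some eone :> option E.
  by apply/oplus_complP; rewrite compl_eone.
move=> /(oplus_assocr x'x)[t -> /oplus_complP ->].
by move/oplus_complP: x'x => <-.
Qed.

Lemma oplus_cancel x y z s :
  oplus x y = Some s -> oplus x z = Some s -> y = z.
Proof.
move=> xy xz; have ss := oplus_compl s.
have [t xt yt] := oplus_assocr (etrans (oplusC y x) xy) ss.
have [u xu zu] := oplus_assocr (etrans (oplusC z x) xz) ss.
move: xu; rewrite xt => -[tu]; subst u.
move: yt zu; rewrite oplusC [oplus z t]oplusC.
by move=> /oplus_complP -> /oplus_complP ->.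
Qed.

Lemma oplus_eq0 x y : oplus x y = Some ezero -> x = ezero.
Proof.
move=> xy; apply: oplus_eone; have := oplusA eone x y.
by rewrite xy /= oplus0; case: (oplus eone x).
Qed.

Definition ea_le x y : bool := `[< exists z, oplus x z = Some y >].

Lemma ea_le_refl : reflexive ea_le.
Proof. by move=> x; apply/asboolP; exists ezero; exact: oplus0. Qed.

Lemma ea_le_anti : antisymmetric ea_le.
Proof.
move=> x y /andP[/asboolP[a xa] /asboolP[b yb]].
have [t ab xt] := oplus_assocr xa yb.
have t0 := oplus_cancel xt (oplus0 x); subst t.
by move: xa; rewrite (oplus_eq0 ab) oplus0 => -[].
Qed.

Lemma ea_le_trans : transitive ea_le.
Proof.
move=> y x z /asboolP[a xa] /asboolP[b yb]; apply/asboolP.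
by have [t _ xt] := oplus_assocr xa yb; exists t.
Qed.

End Basics.

Fact ea_display : Order.disp_t. Proof. exact: Order.Disp tt tt. Qed.

HB.instance Definition _ (E : effectAlgebra) := gen_eqMixin (ea_sort E).
HB.instance Definition _ (E : effectAlgebra) := gen_choiceMixin (ea_sort E).
HB.instance Definition _ (E : effectAlgebra) :=
  Order.Le_isPOrder.Build ea_display (ea_sort E)
    (@ea_le_refl E) (@ea_le_anti E) (@ea_le_trans E).

Lemma ea_leP (E : effectAlgebra) (x y : E) :
  reflect (exists z, oplus x z = Some y) (x <= y).
Proof. exact: asboolP. Qed.

Record subEffectAlgebra (E : effectAlgebra) := SubEffectAlgebra {
  sub_set :> set E;
  sub_eone : sub_set eone;
  sub_oplus : forall x y z : E, oplus x y = Some z ->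
    [/\ sub_set x -> sub_set y -> sub_set z,
        sub_set x -> sub_set z -> sub_set y &
        sub_set y -> sub_set z -> sub_set x]
}.

(* The effect algebra on the subtype of elements of Q, with the inherited
   operation; [obind insub] never turns a defined sum into an undefined one,
   see [omap_val_sub_op]. *)
Section Inherited.
Variables (E : effectAlgebra) (Q : subEffectAlgebra E).
Let S := set_type (sub_set Q).
Implicit Types a b c : S.

Definition sub_op a b : option S := obind insub (oplus (val a) (val b)).

Lemma sub_valP a : sub_set Q (val a).
Proof. exact/set_mem/valP. Qed.

Lemma omap_val_sub_op a b : omap val (sub_op a b) = oplus (val a) (val b).
Proof.
rewrite /sub_op; case ab: (oplus _ _) => [s|//] /=.
case: (sub_oplus Q ab) => /(_ (sub_valP a) (sub_valP b)) Qs _ _.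
by rewrite insubT ?SubK//; apply/mem_set.
Qed.

Lemma sub_compl (x : E) : sub_set Q x -> sub_set Q (compl x).
Proof.
by move=> Qx; case: (sub_oplus Q (oplus_compl x)) => _ + _; apply=> //; exact: sub_eone.
Qed.

Lemma sub_ezero : sub_set Q ezero.
Proof. by rewrite -compl_eone; apply/sub_compl/sub_eone. Qed.

Definition sub_0 : S := Sub ezero (mem_set sub_ezero).
Definition sub_1 : S := Sub eone (mem_set (sub_eone Q)).
Definition sub_c a : S := Sub (compl (val a)) (mem_set (sub_compl (sub_valP a))).

Lemma omap_val_inj : injective (omap (val : S -> E)).
Proof. by move=> [a|] [b|] //= [] /val_inj ->. Qed.

Lemma sub_op_some a b c :
  sub_op a b = Some c <-> oplus (val a) (val b) = Some (val c).
Proof.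
rewrite -omap_val_sub_op; split=> [-> //|].
by move=> h; apply: omap_val_inj; rewrite h.
Qed.

Fact sub_0_neq_1 : sub_0 <> sub_1.
Proof. by move=> /(congr1 val); rewrite !SubK; exact: ezero_neq_eone. Qed.

Fact sub_opC a b : sub_op a b = sub_op b a.
Proof. by rewrite /sub_op oplusC. Qed.

Fact sub_opA a b c :
  obind (fun s => sub_op s c) (sub_op a b) =
  obind (fun s => sub_op a s) (sub_op b c).
Proof.
apply: omap_val_inj; have := oplusA (val a) (val b) (val c).
rewrite -!omap_val_sub_op.
case: (sub_op a b) => [s|]; case: (sub_op b c) => [t|] //=;
  by rewrite !omap_val_sub_op.
Qed.

Fact sub_op_complP a b : sub_op a b = Some sub_1 <-> b = sub_c a.
Proof.
rewrite sub_op_some SubK oplus_complP; split=> [h|->]; last by rewrite SubK.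
by apply: val_inj; rewrite SubK.
Qed.

Fact sub_op_1 a : isSome (sub_op sub_1 a) -> a = sub_0.
Proof.
move=> h; apply: val_inj; rewrite SubK; apply: oplus_eone.
by have := omap_val_sub_op sub_1 a; rewrite SubK => <-; case: (sub_op _ _) h.
Qed.

Definition inherited : effectAlgebra :=
  EffectAlgebra sub_0_neq_1 sub_opC sub_opA sub_op_complP sub_op_1.

End Inherited.

Definition riesz_decomposition (E : effectAlgebra) : Prop :=
  forall u v1 v2 v : E, oplus v1 v2 = Some v -> u <= v ->
  exists u1 u2 : E, [/\ u1 <= v1, u2 <= v2 & oplus u1 u2 = Some u].

Definition homogeneous (E : effectAlgebra) : Prop :=
  forall u v1 v2 v : E, oplus v1 v2 = Some v -> u <= v -> v <= compl u ->
  exists u1 u2 : E, [/\ u1 <= v1, u2 <= v2 & oplus u1 u2 = Some u].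

Definition block (E : effectAlgebra) (Q : subEffectAlgebra E) : Prop :=
  riesz_decomposition (inherited Q) /\
  forall P : subEffectAlgebra E, riesz_decomposition (inherited P) ->
    sub_set Q `<=` sub_set P -> sub_set P `<=` sub_set Q.

Definition is_lattice (E : effectAlgebra) : Prop :=
  forall x y : E,
    supremums [set x; y] !=set0 /\ infimums [set x; y] !=set0.

Definition osum (E : effectAlgebra) (a b : option E) : option E :=
  obind (fun x => obind (oplus x) b) a.

Section OsumMonoid.
Variable E : effectAlgebra.

Fact osumA : associative (@osum E).
Proof.
move=> [x|] [y|] [z|] //=; last by case: (oplus x y).
by have := oplusA x y z; rewrite /osum /=; case: (oplus x y).
Qed.

Fact osumC : commutative (@osum E).
Proof. by move=> [x|] [y|] //=; rewrite /osum /= oplusC. Qed.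

Fact osum0 : left_id (Some ezero) (@osum E).
Proof. by move=> [x|] //=; rewrite /osum /= oplusC oplus0. Qed.

HB.instance Definition _ :=
  Monoid.isComLaw.Build (option E) (Some ezero) (@osum E) osumA osumC osum0.

End OsumMonoid.

(* A system is a family [x] indexed by an arbitrary [H] (every type carries a
   choiceType structure classically, see [{classic H}]), a finite subsystem is
   a finite set of indices, and [None] is the value of an undefined sum. *)
Definition finsum (E : effectAlgebra) (H : choiceType) (x : H -> E)
    (K : {fset H}) : option E :=
  \big[@osum E/Some ezero]_(k <- K) Some (x k).

Definition orthogonal_system (E : effectAlgebra) (H : choiceType)
    (x : H -> E) : Prop :=
  forall K : {fset H}, isSome (finsum x K).

Definition orthosummable (E : effectAlgebra) (H : choiceType)
    (x : H -> E) : Prop :=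
  supremums [set s : E | exists K : {fset H}, finsum x K = Some s] !=set0.

Definition orthocomplete (E : effectAlgebra) : Prop :=
  forall (H : choiceType) (x : H -> E),
    orthogonal_system x -> orthosummable x.

(* Main.v *)
Require Import Defs.
From mathcomp Require Import all_boot all_order.
From mathcomp Require Import finmap zify.
From mathcomp Require Import boolp classical_sets.

(** In an orthocomplete effect algebra any two elements have a maximal lower
    bound, by Zorn's lemma applied to orthogonal systems. In an effect algebra
    with the Riesz decomposition property a maximal lower bound is an infimum,
    by interpolation. To see that a maximal lower bound of two elements [x], [y]
    of a block [Q] can be found inside [Q], write [x = p + q], [y = p + r] in [Q]
    with [q + r] defined and take a maximal lower bound [t] of [q] and [r] in
    [E]; then [t <= r <= t'], and [p + t] is a maximal lower bound of [x], [y].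

    So one needs: if [y <= c <= y'] and [c] lies in [Q], then [y] lies in [Q].
    Start from the finite decompositions of [1] in [Q] and split repeatedly an
    entry [c] into [y] and the rest whenever [y <= c <= y']. Homogeneity allows
    such a split to be carried over to any refinement, so the resulting
    decompositions of [1] have common refinements and their partial sums form
    a sub-effect algebra with the Riesz decomposition property. It contains [Q]
    and all those [y], so it equals [Q] by maximality. *)

Set Implicit Arguments.
Unset Strict Implicit.
Unset Printing Implicit Defensive.

Import Order.TTheory.

Local Open Scope classical_set_scope.
Local Open Scope order_scope.

(** * Order, complement and cancellation in effect algebras *)

Section Order.
Variable E : effectAlgebra.
Implicit Types x y z s t u : E.

Lemma oplus_lel x y s : oplus x y = Some s -> x <= s.
Proof. by move=> xy; apply/ea_leP; exists y. Qed.

Lemma oplus_ler x y s : oplus x y = Some s -> y <= s.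
Proof. by rewrite oplusC; exact: oplus_lel. Qed.

Lemma le_complP x y : reflect (exists s, oplus x y = Some s) (x <= compl y).
Proof.
apply: (iffP (ea_leP _ _)) => [[t xt]|[s xy]].
  have ty := oplus_compl y; rewrite oplusC in ty; rewrite oplusC in xt.
  by have [s xy _] := oplus_assocr xt ty; exists s.
rewrite oplusC in xy; have [t xs /oplus_complP ty] := oplus_assocr xy (oplus_compl s).
by exists (compl s); rewrite xs ty.
Qed.

Lemma le_compl_sym x y : (x <= compl y) = (y <= compl x).
Proof. by apply/le_complP/le_complP => -[s xy]; exists s; rewrite oplusC. Qed.

Lemma complK : involutive (@compl E).
Proof.
by move=> x; have := oplus_compl x; rewrite oplusC => /oplus_complP <-.
Qed.

Lemma le_compl x y : x <= y -> compl y <= compl x.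
Proof. by move=> xy; rewrite le_compl_sym complK. Qed.

Lemma oplus_mono x y u s : x <= y -> oplus y u = Some s ->
  exists2 t, oplus x u = Some t & t <= s.
Proof.
move=> /ea_leP[r xr] yu; rewrite oplusC in xr.
by have [t xu rt] := oplus_assocr xr yu; exists t => //; exact: oplus_ler rt.
Qed.

Lemma oplus_le_cancel x y z s t :
  oplus x y = Some s -> oplus x z = Some t -> s <= t -> y <= z.
Proof.
move=> xy xz /ea_leP[r sr]; have [q yr xq] := oplus_assocr xy sr.
by rewrite -(oplus_cancel xq xz); exact: oplus_lel yr.
Qed.

Lemma le0e x : ezero <= x.
Proof. by apply/ea_leP; exists x; rewrite oplusC oplus0. Qed.

Lemma lee1 x : x <= eone.
Proof. exact: oplus_lel (oplus_compl x). Qed.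

Lemma lee0 x : x <= ezero -> x = ezero.
Proof. by move=> /ea_leP[y]; exact: oplus_eq0. Qed.

End Order.

(* The interpolant of [w, t <= x, y] obtained from decomposing [t] along
   [x = w + a] and then along [y = w + c] has the form [w + g], so that it
   equals [w] by maximality. *)
Lemma riesz_maximal_lbound (E : effectAlgebra) (x y w : E) :
  riesz_decomposition E -> w <= x -> w <= y ->
  (forall z, w <= z -> z <= x -> z <= y -> z = w) ->
  forall t, t <= x -> t <= y -> t <= w.
Proof.
move=> rdp /ea_leP[a wa] /ea_leP[c wc] wmax t tx ty.
have [e [k [/ea_leP[h eh] ka ek]]] := rdp _ _ _ _ wa tx.
have [s hc es] := oplus_assocr eh wc.
have [f [g [fh gc fg]]] := rdp _ _ _ _ hc (oplus_le_cancel ek es ty).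
have ga : g <= a := le_trans (oplus_ler fg) ka.
rewrite oplusC in wa; have [z gw zx] := oplus_mono ga wa.
rewrite oplusC in wc; have [z' gw' zy] := oplus_mono gc wc.
move: gw'; rewrite gw => -[?]; subst z'.
have zw := wmax _ (oplus_ler gw) zx zy; subst z.
move: gw; rewrite oplusC => /oplus_cancel /(_ (oplus0 _)) g0; subst g.
move: fg; rewrite oplus0 => -[fk]; subst f.
rewrite oplusC in eh; have [r] := oplus_mono fh eh.
by rewrite oplusC ek => -[->].
Qed.

(** * Maximal lower bounds from orthocompleteness *)

Section MaximalLowerBound.
Variable E : effectAlgebra.
Hypothesis E_orthocomplete : orthocomplete E.

(* Every element is available infinitely often: if the sum [w] of a maximal
   system can be enlarged by [d], then the system contains all the [(d, n)],
   so that [d + w <= w]. *)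
Let H : choiceType := (E * nat)%type.

(** Padding with zero outside [A] keeps one index type for all systems, so that Zorn's lemma applies
    to subsets of [H] under inclusion. *)
Let system (A : set H) (k : H) : E := if `[< A k >] then k.1 else ezero.

Let bounded u v (A : set H) := forall K : {fset H},
  exists s, [/\ finsum (system A) K = Some s, s <= u & s <= v].

Lemma finsumD1 (x : H -> E) (k : H) (K : {fset H}) : k \in K ->
  finsum x K = osum (Some (x k)) (finsum x (K `\ k)%fset).
Proof. by move=> kK; rewrite /finsum (big_fsetD1 k). Qed.

Lemma eq_finsum (x y : H -> E) (K : {fset H}) :
  {in K, x =1 y} -> finsum x K = finsum y K.
Proof. by move=> xy; apply: eq_big_seq => k /xy ->. Qed.

Lemma maximal_lbound (u v : E) :
  exists w, [/\ w <= u, w <= v &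
    forall z, w <= z -> z <= u -> z <= v -> z = w].
Proof.
have bounded_bigcup (F : set (set H)) : F `<=` bounded u v ->
    total_on F subset -> bounded u v (\bigcup_(X in F) X).
  move=> Fb Ftot K.
  (* On the finite set [K] the union of the chain agrees with a single bounded [X]: a member of the
     chain, or the empty set if the union misses [K]. *)
  suff [X [Xb XF XK]] : exists X, [/\ bounded u v X, X `<=` \bigcup_(X in F) X &
      {in K, forall k, (\bigcup_(X in F) X) k -> X k}].
    have [s [sK su sv]] := Xb K; exists s; split=> //; rewrite -sK.
    apply: eq_finsum => k kK; rewrite /system.
    congr (if _ then _ else _); apply: asbool_equiv_eq.
    by split; [exact: XK|exact: XF].
  have b0 : bounded u v set0.
    move=> L; exists ezero; split; [|exact: le0e|exact: le0e].
    rewrite /finsum big1_seq // => k _; rewrite /system.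
    by case: asboolP.
  suff [X [XF XK]] : exists X, (F X \/ X = set0) /\
      {in K, forall k, (\bigcup_(X in F) X) k -> X k}.
    exists X; split=> //; first by case: XF => [/Fb|->].
    by case: XF => [FX k Xk|->//]; exists X.
  have : exists X, (F X \/ X = set0) /\
      {in enum_fset K, forall k, (\bigcup_(X in F) X) k -> X k}; last by [].
  elim: (enum_fset K) => [|k r [X [XF Xr]]]; first by exists set0; split; [right|].
  have [[Y FY Yk]|nk] := pselect ((\bigcup_(X in F) X) k); last first.
    exists X; split=> // l; rewrite inE => /orP[/eqP -> /nk//|]; exact: Xr.
  have [XY|YX] : X `<=` Y \/ Y `<=` X.
  - by case: XF => [FX|->]; [exact: Ftot|left].
  - exists Y; split; first by left.
    by move=> l; rewrite inE => /orP[/eqP -> //|/Xr Xl /Xl /XY].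
  - exists X; split=> // l; rewrite inE => /orP[/eqP -> _|]; [exact: YX|exact: Xr].
have [A [Ab Amax]] := Zorn_bigcup bounded_bigcup.
have [|w [wub wlub]] := E_orthocomplete (x := system A).
  by move=> K; have [s [->]] := Ab K.
have Kw K s : finsum (system A) K = Some s -> s <= w.
  by move=> Ks; apply: wub; exists K.
have wu : w <= u by apply: wlub => s [K Ks]; have [r []] := Ab K; rewrite Ks => -[->].
have wv : w <= v by apply: wlub => s [K Ks]; have [r []] := Ab K; rewrite Ks => -[->].
exists w; split=> // z /ea_leP[d wd] zu zv.
(* Adjoining a missing [(d, n)] would keep all finite sums below [w + d = z], hence below [u] and
   [v], against the maximality of [A]. *)
have Ad n : A (d, n).
  apply: contrapT => nAd.
  apply: (Amax ((d, n) |` A)).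
    by split; [exact: subsetUr|move=> /(_ (d, n)) dn; apply/nAd/dn; left].
  move=> K.
  have eqA L : (d, n) \notin L -> finsum (system ((d, n) |` A)) L = finsum (system A) L.
    move=> dnL; apply: eq_finsum => k kL; rewrite /system; congr (if _ then _ else _).
    apply: asbool_equiv_eq; split; last by right.
    by move=> [/= kdn|//]; rewrite kdn in kL; rewrite kL in dnL.
  have [dnK|/eqA ->] := boolP ((d, n) \in K); last exact: Ab.
  have [s [sK _ _]] := Ab (K `\ (d, n))%fset.
  rewrite (finsumD1 _ dnK) eqA; last by rewrite !inE eqxx.
  have [t st tz] := oplus_mono (Kw _ _ sK) wd.
  exists t; rewrite sK /osum /= /system asboolT; last by left.
  by rewrite oplusC st; split=> //; [exact: le_trans zu|exact: le_trans zv].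
have addd K s : finsum (system A) K = Some s ->
    exists2 t, oplus d s = Some t & t <= w.
  (* A copy of [d] whose index exceeds all those in [K] is fresh, so [d + s] is again a finite sum
     of the system. *)
  move=> sK; have [n nK] : exists n, (d, n) \notin K.
    exists (\max_(k <- enum_fset K) k.2).+1; apply/negP => dK.
    by have := @leq_bigmax_seq H (enum_fset K) xpredT (fun k => k.2) _ dK isT;
      rewrite ltnn.
  have := finsumD1 (system A) (fset1U1 (d, n) K).
  rewrite fsetU1K // sK [in RHS]/system asboolT //=.
  have [t [tK _ _]] := Ab ((d, n) |` K)%fset.
  by rewrite tK => dt; exists t => //; exact: Kw tK.
have [|t d0 tw] := addd fset0 ezero; first by rewrite /finsum big_seq_fset0.
have dw : d <= w := le_trans (oplus_lel d0) tw.
have /ea_leP[w0 dw0] := dw.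
(* With [w = d + w0], every finite sum [s] satisfies [d + s <= w], so [w0] bounds them all; this
   forces [w0 = w] and [d = 0]. *)
have ww0 : w <= w0.
  by apply: wlub => s [K /addd[r ds rw]]; exact: oplus_le_cancel ds dw0 rw.
have w0w : w0 = w by apply/le_anti; rewrite ww0 (oplus_ler dw0).
move: dw0; rewrite w0w oplusC => /oplus_cancel /(_ (oplus0 _)) d00.
by move: wd; rewrite d00 oplus0 => -[->].
Qed.

End MaximalLowerBound.

(** * Refinement of finite decompositions *)

(** Riesz refinement for multisets: [a], [b], [c], [d] play the role of the pairwise intersections
    of the two partitions. *)
Lemma perm_cat_refine (T : eqType) (A B A2 B2 : seq T) :
  perm_eq (A ++ B) (A2 ++ B2) -> exists a b c d,
  [/\ perm_eq A (a ++ b), perm_eq B (c ++ d),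
      perm_eq A2 (a ++ c) & perm_eq B2 (b ++ d)].
Proof.
elim: A A2 B2 => [|e A IH] A2 B2 /= p.
  by exists [::], [::], A2, B2; split.
have : e \in A2 ++ B2 by rewrite -(perm_mem p) mem_head.
rewrite mem_cat => /orP[] /perm_to_rem q.
- have [|a [b [c [d [pa pb pc pd]]]]] := IH (rem e A2) B2.
    by rewrite -(perm_cons e) (perm_trans p) // -cat_cons perm_cat2r.
  exists (e :: a), b, c, d; split=> //=; first by rewrite perm_cons.
  by rewrite (perm_trans q) // perm_cons.
- have [|a [b [c [d [pa pb pc pd]]]]] := IH A2 (rem e B2).
    rewrite -(perm_cons e) (perm_trans p) // perm_sym -cat1s perm_catCA.
    by rewrite perm_cat2l perm_sym.
  exists a, (e :: b), c, d; split=> //=.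
    by rewrite perm_sym -cat1s perm_catCA /= perm_cons perm_sym.
  by rewrite (perm_trans q) // perm_cons.
Qed.

Section Refinement.
Variable E : effectAlgebra.
Implicit Types (c x y z u v : E) (s t A B C D F : seq E).

Definition lsum s : option E := \big[@osum E/Some ezero]_(c <- s) Some c.

Lemma lsum_nil : lsum [::] = Some ezero.
Proof. exact: big_nil. Qed.

Lemma lsum_cons c s : lsum (c :: s) = osum (Some c) (lsum s).
Proof. exact: big_cons. Qed.

Lemma lsum_cat s t : lsum (s ++ t) = osum (lsum s) (lsum t).
Proof. exact: big_cat. Qed.

Lemma lsum1 c : lsum [:: c] = Some c.
Proof. exact: big_seq1. Qed.

Lemma perm_lsum s t : perm_eq s t -> lsum s = lsum t.
Proof. exact: perm_big. Qed.

Lemma osum_SomeP (a b : option E) z : osum a b = Some z ->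
  exists x y, [/\ a = Some x, b = Some y & oplus x y = Some z].
Proof. by case: a b => [x|] [y|] //= xy; exists x, y. Qed.

Lemma lsum_catP s t z : lsum (s ++ t) = Some z ->
  exists x y, [/\ lsum s = Some x, lsum t = Some y & oplus x y = Some z].
Proof. by rewrite lsum_cat; exact: osum_SomeP. Qed.

Lemma lsum_cat_SomeP s t x z : lsum s = Some x -> lsum (s ++ t) = Some z ->
  exists2 y, lsum t = Some y & oplus x y = Some z.
Proof. by move=> sx /lsum_catP[x2 [y []]]; rewrite sx => -[<-]; exists y. Qed.

(** The refinement relation between decompositions, up to order. A group [Dc] may be empty, as a
    decomposition of zero. *)
Fixpoint fine C D : Prop :=
  if C is c :: C' then exists Dc D',
    [/\ perm_eq D (Dc ++ D'), lsum Dc = Some c & fine C' D']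
  else D = [::].

Lemma fine_perml C D F : perm_eq D F -> fine C D -> fine C F.
Proof.
case: C => [|c C] /= p; first by move=> D0; subst D; apply/perm_nilP; rewrite perm_sym.
move=> [Dc [D' [q sc f]]]; exists Dc, D'; split=> //.
by rewrite perm_sym in p; exact: perm_trans p q.
Qed.

Lemma fine_refl C : fine C C.
Proof. by elim: C => //= c C IH; exists [:: c], C; rewrite lsum1. Qed.

Lemma fine_cat A B C D : fine A C -> fine B D -> fine (A ++ B) (C ++ D).
Proof.
elim: A C => [|a A IH] C /=; first by move=> ->.
move=> [Ca [C' [p sa f]]] g; exists Ca, (C' ++ D); split=> //; last exact: IH.
by rewrite catA perm_cat2r.
Qed.

Lemma fine_catP A B F : fine (A ++ B) F ->
  exists C D, [/\ perm_eq F (C ++ D), fine A C & fine B D].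
Proof.
elim: A F => [|a A IH] F /=; first by exists [::], F.
move=> [Fa [F' [p sa /IH[C [D [q f g]]]]]].
exists (Fa ++ C), D; split=> //; last by exists Fa, C.
by rewrite -catA (perm_trans p) // perm_cat2l.
Qed.

Lemma fine_lsum C D : fine C D -> lsum D = lsum C.
Proof.
elim: C D => [|c C IH] D /= => [->//|[Dc [D' [p sc /IH sD]]]].
by rewrite (perm_lsum p) lsum_cat sc sD lsum_cons.
Qed.

Lemma fine_rem c C F : c \in C -> fine C F -> exists Fc F',
  [/\ perm_eq F (Fc ++ F'), lsum Fc = Some c & fine (rem c C) F'].
Proof.
elim: C F => //= a C IH F; rewrite inE eq_sym; case: eqP => [-> _ //|_ /= cC].
move=> [Fa [F' [p sa /(IH _ cC)[Fc [F2 [q sc f]]]]]].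
exists Fc, (Fa ++ F2); split=> //; last by exists Fa, F2.
by rewrite perm_sym perm_catCA perm_sym (perm_trans p) // perm_cat2l.
Qed.

Lemma fine_permr C D F : perm_eq C D -> fine C F -> fine D F.
Proof.
elim: D C F => [|d D IH] C F p; first by rewrite (perm_nilP p).
have dC : d \in C by rewrite (perm_mem p) mem_head.
move=> /(fine_rem dC)[Fd [F' [q sd f]]]; exists Fd, F'; split=> //.
apply: IH f; rewrite -(perm_cons d) perm_sym.
by rewrite (perm_trans _ (perm_to_rem dC)) // perm_sym.
Qed.

Lemma fine_trans D C F : fine C D -> fine D F -> fine C F.
Proof.
elim: C D F => [|c C IH] D F /= => [->//|[Dc [D' [p sc f]]]].
move=> /(fine_permr p) /fine_catP[Fc [F' [q g h]]].
by exists Fc, F'; split=> //; [rewrite (fine_lsum g)|exact: IH h].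
Qed.

(** * Refinement by controlled splits *)

Section Split.
Variable K : E -> E -> Prop.

Inductive split : seq E -> seq E -> Prop :=
| split_perm s t : perm_eq s t -> split s t
| split_trans t s F : split s t -> split t F -> split s F
| split_step c y z s : oplus y z = Some c -> K y c ->
    split (c :: s) (y :: z :: s).

Lemma split_cat s t F : split s t -> split (s ++ F) (t ++ F).
Proof.
move=> st; elim: st F => {s t} [s t p|t s u _ IH1 _ IH2|c y z s yz Kyc] F /=.
- by apply: split_perm; rewrite perm_cat2r.
- exact: split_trans (IH1 F) (IH2 F).
- exact: split_step.
Qed.

Lemma split_catl s t F : split s t -> split (F ++ s) (F ++ t).
Proof.
move=> /(split_cat F) st; apply: split_trans (split_trans st _);
  by apply: split_perm; rewrite perm_catC.
Qed.

Lemma split_fine s t : split s t -> fine s t.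
Proof.
elim=> {s t} [s t p|t s u _ IH1 _ IH2|c y z s yz _].
- exact: fine_perml p (fine_refl s).
- exact: fine_trans IH1 IH2.
- exists [:: y; z], s; split=> //; last exact: fine_refl.
  by rewrite lsum_cons lsum1.
Qed.

Variable M : set E.
Hypothesis M_oplus : forall x y z, oplus x y = Some z -> M x -> M y -> M z.
Hypothesis M_ezero : M ezero.
(** Common form of the Riesz property of [Q] ([M] is [Q], [K u v] says that [u] lies in [Q]) and of
    homogeneity ([M] is everything, [K u v] is [u <= compl v]). *)
Hypothesis K_decomposition : forall u v1 v2 v, M v1 -> M v2 ->
  oplus v1 v2 = Some v -> u <= v -> K u v ->
  exists u1 u2, [/\ u1 <= v1, u2 <= v2, oplus u1 u2 = Some u, K u1 v1 & K u2 v2].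

(** Decompose [y] along [d + x], with [x] the sum of the tail: the part below [d] costs one split of
    [d], the part below [x] is handled by induction. This needs [x] in [M], hence the stronger claim
    [main]. *)
Lemma split_along D y c : {in D, forall d, M d} -> lsum D = Some c ->
  y <= c -> K y c ->
  exists F1 F2, split D (F1 ++ F2) /\ lsum F1 = Some y.
Proof.
suff main : {in D, forall d, M d} -> forall c, lsum D = Some c -> M c /\
  forall y, y <= c -> K y c ->
  exists F1 F2, split D (F1 ++ F2) /\ lsum F1 = Some y.
  by move=> MD sD yc Kyc; exact: (main MD _ sD).2.
elim: D {c y} => [_|d D IH MD] c.
  rewrite lsum_nil => -[<-]; split=> // y /lee0 -> _.
  by exists [::], [::]; rewrite lsum_nil; split=> //; exact: split_perm.
rewrite lsum_cons => /osum_SomeP[_ [x [[<-] sD dx]]].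
have Md : M d by apply: MD; exact: mem_head.
have [|Mx {}IH] := IH _ x sD; first by move=> e eD; apply: MD; rewrite inE eD orbT.
split=> [|y yc Kyc]; first exact: M_oplus dx Md Mx.
have [u1 [u2 [/ea_leP[r u1r] u2x u12 K1 K2]]] := K_decomposition Md Mx dx yc Kyc.
have [F1 [F2 [sF s2]]] := IH _ u2x K2.
exists (u1 :: F1), (r :: F2); rewrite lsum_cons s2; split=> //=.
apply: split_trans (split_step D u1r K1) _.
apply: split_trans (split_catl [:: u1; r] sF) _.
apply: split_perm; rewrite /= perm_cons -cat1s perm_catCA perm_cat2l //.
Qed.

End Split.

End Refinement.

(** * Order and Riesz decomposition in a sub-effect algebra *)

Section Inherited.
Variables (E : effectAlgebra) (Q : subEffectAlgebra E).

Lemma inherited_le (a b : set_type (sub_set Q)) :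
  ((a : inherited Q) <= (b : inherited Q)) = (val a <= val b).
Proof.
apply/ea_leP/ea_leP => [[c /sub_op_some ac]|[z az]]; first by exists (val c).
have [_ Qz _] := sub_oplus Q az.
exists (Sub z (mem_set (Qz (sub_valP a) (sub_valP b)))).
by apply/sub_op_some; rewrite SubK.
Qed.

Lemma inherited_riesz_decomposition :
  riesz_decomposition (inherited Q) <->
  forall u v1 v2 v : E, sub_set Q u -> sub_set Q v1 -> sub_set Q v2 ->
    oplus v1 v2 = Some v -> u <= v ->
    exists u1 u2, [/\ sub_set Q u1, sub_set Q u2, u1 <= v1, u2 <= v2 &
                      oplus u1 u2 = Some u].
Proof.
split=> [rdp u v1 v2 v Qu Q1 Q2 v12 uv|rdp u v1 v2 v /sub_op_some v12].
  have Qv : sub_set Q v by have [+ _ _] := sub_oplus Q v12; exact.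
  have [] := rdp (Sub u (mem_set Qu)) (Sub v1 (mem_set Q1)) (Sub v2 (mem_set Q2))
    (Sub v (mem_set Qv)).
  - by apply/sub_op_some; rewrite !SubK.
  - by rewrite inherited_le !SubK.
  move=> u1 [u2 []]; rewrite !inherited_le !SubK => le1 le2 /sub_op_some.
  by rewrite SubK => u12; exists (val u1), (val u2); split=> //; exact: sub_valP.
rewrite inherited_le => uv.
have [u1 [u2 [Q1 Q2 le1 le2 u12]]] :=
  rdp _ _ _ _ (sub_valP u) (sub_valP v1) (sub_valP v2) v12 uv.
exists (Sub u1 (mem_set Q1)), (Sub u2 (mem_set Q2)).
by rewrite !inherited_le !SubK; split=> //; apply/sub_op_some; rewrite !SubK.
Qed.

End Inherited.

(** * The hull of [Q] under homogeneous splits *)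

Section Hull.
Variables (E : effectAlgebra) (Q : subEffectAlgebra E).
Hypothesis E_homogeneous : homogeneous E.
Hypothesis Q_rdp : riesz_decomposition (inherited Q).
Implicit Types (c x y z u v : E) (s t A B C D F X Y Z V W : seq E).

Let in_sub D := {in D, forall d, sub_set Q d}.

Let isplit := split (fun y c => y <= compl c).

Lemma in_sub_split s t : split (fun y _ => sub_set Q y) s t -> in_sub s -> in_sub t.
Proof.
elim=> {s t} [s t p|s t u _ IH1 _ IH2 /IH1/IH2//|c y z s yz Qy] Qs.
  by move=> d; rewrite -(perm_mem p); exact: Qs.
have Qc : sub_set Q c by apply: Qs; exact: mem_head.
move=> d; rewrite !inE => /or3P[/eqP-> //|/eqP->|ds].
- by have [_ + _] := sub_oplus Q yz; exact.
- by apply: Qs; rewrite inE ds orbT.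
Qed.

Lemma fine_nil D : lsum D = Some ezero -> fine D [::].
Proof.
elim: D => //= d D IH; rewrite lsum_cons => /osum_SomeP[_ [x [[<-] sD dx]]].
exists [::], [::]; rewrite lsum_nil (oplus_eq0 dx); split=> //.
by apply: IH; rewrite sD; rewrite oplusC in dx; rewrite (oplus_eq0 dx).
Qed.

(** Induction on [C]: its head [c] lies in [Q], so the Riesz property splits [D] along [c], and the
    rest of [D] has the same sum as the tail of [C]. *)
Lemma in_sub_refine C D x : in_sub C -> in_sub D ->
  lsum C = Some x -> lsum D = Some x ->
  exists F, [/\ in_sub F, fine C F & fine D F].
Proof.
elim: C D x => [|c C IH] D x QC QD.
  by rewrite lsum_nil => -[<-] sD; exists [::]; split=> //; exact: fine_nil.
rewrite lsum_cons => /osum_SomeP[_ [y [[<-] sC cy]]] sD.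
have Qc : sub_set Q c by apply: QC; exact: mem_head.
have [||u v1 v2 v Q1 Q2 v12 uv Qu||F1 [F2 [sF s1]]] := @split_along E
  (fun y _ => sub_set Q y) (sub_set Q) _ _ _ D c x _ sD (oplus_lel cy) Qc.
- by move=> a b r ab Qa Qb; have [+ _ _] := sub_oplus Q ab; exact.
- exact: sub_ezero.
- have [u1 [u2 [? ? ? ? ?]]] :=
    (inherited_riesz_decomposition Q).1 Q_rdp _ _ _ _ Qu Q1 Q2 v12 uv.
  by exists u1, u2.
- exact: QD.
have QF := in_sub_split sF QD.
have := fine_lsum (split_fine sF); rewrite sD => /(lsum_cat_SomeP s1)[y' s2 cy'].
have ?:= oplus_cancel cy cy'; subst y'.
have [|d dF|F [QF' f1 f2]] := IH F2 y _ _ sC s2.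
- by move=> d dC; apply: QC; rewrite inE dC orbT.
- by apply: QF; rewrite mem_cat dF orbT.
exists (F1 ++ F); split.
- move=> d; rewrite mem_cat => /orP[dF|]; last exact: QF'.
  by apply: QF; rewrite mem_cat dF.
- by exists F1, F.
- apply: fine_trans (split_fine sF) _; exact: fine_cat (fine_refl F1) f2.
Qed.

(** The side condition is inherited by the parts, since [ui <= u <= v' <= vi']; homogeneity can
    therefore be iterated along [D]. *)
Lemma isplit_along D y c : lsum D = Some c -> y <= c -> y <= compl c ->
  exists F1 F2, isplit D (F1 ++ F2) /\ lsum F1 = Some y.
Proof.
move=> sD yc yc'.
apply: (@split_along E _ setT _ _ _ D y c _ sD yc yc') => // u v1 v2 v _ _ v12 uv uv'.
have [|u1 [u2 [le1 le2 u12]]] := E_homogeneous v12 uv; first by rewrite le_compl_sym.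
exists u1, u2; split=> //.
- apply: le_trans (oplus_lel u12) (le_trans uv' (le_compl (oplus_lel v12))).
- apply: le_trans (oplus_ler u12) (le_trans uv' (le_compl (oplus_ler v12))).
Qed.

Definition good D := exists C, [/\ in_sub C, lsum C = Some eone & isplit C D].

Lemma good_split D F : isplit D F -> good D -> good F.
Proof. by move=> DF [C [QC sC CD]]; exists C; split=> //; exact: split_trans DF. Qed.

Lemma good_perm D F : perm_eq D F -> good D -> good F.
Proof. by move=> p; apply: good_split; exact: split_perm. Qed.

Lemma good_lsum D : good D -> lsum D = Some eone.
Proof. by move=> [C [_ <- CD]]; exact: fine_lsum (split_fine CD). Qed.

(** A split of [c] into [y] and [z] is imitated in [F] by splitting along [y] the group of entries
    that sums to [c]; homogeneity makes these splits admissible. *)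
Lemma good_isplit_refine C D F : isplit C D -> good F -> fine C F ->
  exists F', [/\ good F', fine F F' & fine D F'].
Proof.
move=> CD; elim: CD F => {C D} [s t p|s t u _ IH1 _ IH2|c y z s yz yc'] F gF f.
- by exists F; split=> //; [exact: fine_refl|exact: fine_permr p f].
- have [F1 [g1 f1 t1]] := IH1 _ gF f; have [F2 [g2 f2 t2]] := IH2 _ g1 t1.
  by exists F2; split=> //; exact: fine_trans f2.
have [Fc [F' [p sc f']]] := f.
have [F1 [F2 [sF s1]]] := isplit_along sc (oplus_lel yz) yc'.
have FF : isplit F ((F1 ++ F2) ++ F').
  exact: split_trans (split_perm _ p) (split_cat F' sF).
exists ((F1 ++ F2) ++ F'); split; [exact: good_split FF gF|exact: split_fine FF|].
exists F1, (F2 ++ F'); rewrite -catA; split=> //; exists F2, F'; split=> //.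
have := fine_lsum (split_fine sF); rewrite sc => /(lsum_cat_SomeP s1)[z' -> yz'].
by congr Some; exact: oplus_cancel yz' yz.
Qed.

(** The starting decompositions have a common refinement in [Q], to which the splits leading to [D1]
    and then those leading to [D2] are carried over. *)
Lemma good_refine D1 D2 : good D1 -> good D2 ->
  exists F, [/\ good F, fine D1 F & fine D2 F].
Proof.
move=> [C1 [Q1 s1 CD1]] [C2 [Q2 s2 CD2]].
have [C [QC f1 f2]] := in_sub_refine Q1 Q2 s1 s2.
have gC : good C by exists C; rewrite (fine_lsum f1); split=> //; exact: split_perm.
have [F1 [g1 CF1 DF1]] := good_isplit_refine CD1 gC f1.
have [F2 [g2 FF2 DF2]] := good_isplit_refine CD2 g1 (fine_trans f2 CF1).
by exists F2; split=> //; exact: fine_trans FF2.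
Qed.

Definition hull : set E := [set x | exists A B, good (A ++ B) /\ lsum A = Some x].

Local Ltac solve_perm := apply/permP => ?; rewrite !count_cat; lia.

(* Let [a] be the common part of the decompositions of [x <= z], so that
   [x = a + b] and [z = a + k]. Then [b <= k <= b'], hence [k] splits along [b]. *)
Lemma hull_nested Z W z x : good (Z ++ W) -> lsum Z = Some z -> hull x -> x <= z ->
  exists X Y V, [/\ good (X ++ Y ++ V), lsum X = Some x,
                    fine Z (X ++ Y) & fine W V].
Proof.
move=> gZ sZ [A [B [gA sA]]] xz.
have [F [gF /fine_catP[Z1 [W1 [pZ fZ fW]]] /fine_catP[A1 [B1 [pA fA _]]]]] :=
  good_refine gZ gA.
have [|a [b [k [l [qA qB qZ qW]]]]] := @perm_cat_refine _ A1 B1 Z1 W1.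
  by rewrite perm_sym in pA; exact: perm_trans pA pZ.
(* Since [b] and [k] are disjoint parts of a decomposition of 1, their sums are summable, which
   gives [xb <= compl xc]. *)
have pF : perm_eq F ((b ++ k) ++ (a ++ l)).
  rewrite (perm_trans pZ) // (perm_trans (perm_cat qZ qW)) //; solve_perm.
have := good_lsum gF; rewrite (perm_lsum pF) => /lsum_catP[r [e []]].
move=> /lsum_catP[xb [xc [sb sc bc]]] _ _.
have := fine_lsum fA; rewrite sA (perm_lsum qA) => /lsum_catP[xa [xb' [sa]]].
rewrite sb => -[<-] ab.
have := fine_lsum fZ; rewrite sZ (perm_lsum qZ) => /(lsum_cat_SomeP sa)[xc'].
rewrite sc => -[<-] ac.
have [|F1 [F2 [sF s1]]] := isplit_along sc (oplus_le_cancel ab ac xz).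
  by apply/le_complP; exists r.
exists (a ++ F1), F2, (b ++ l); split.
- have g : good (k ++ (a ++ b ++ l)).
    by apply: good_perm gF; rewrite (perm_trans pF) //; solve_perm.
  apply: good_perm (good_split (split_cat _ sF) g); solve_perm.
- by rewrite lsum_cat sa s1.
- apply: fine_trans fZ (fine_permr _ (fine_perml _ (split_fine (split_catl a sF)))).
    by rewrite perm_sym.
  solve_perm.
- exact: fine_perml qW fW.
Qed.

Lemma hull_difference x y z : oplus x y = Some z -> hull x -> hull z -> hull y.
Proof.
move=> xy hx [Z [W [gZ sZ]]].
have [X [Y [V [gX sX fZ fW]]]] := hull_nested gZ sZ hx (oplus_lel xy).
exists Y, (X ++ V); split; first by apply: good_perm gX; solve_perm.
have := fine_lsum fZ; rewrite sZ => /(lsum_cat_SomeP sX)[y' -> xy'].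
by congr Some; exact: oplus_cancel xy' xy.
Qed.

Lemma hull_sub : sub_set Q `<=` hull.
Proof.
move=> x Qx; exists [:: x], [:: compl x]; rewrite lsum1; split=> //.
exists [:: x; compl x]; rewrite lsum_cons lsum1 /= oplus_compl; split=> //.
  by move=> d; rewrite !inE => /orP[] /eqP -> //; exact: sub_compl.
exact: split_perm.
Qed.

Lemma hull_eone : hull eone.
Proof. exact/hull_sub/sub_eone. Qed.

Lemma hull_compl x : hull x -> hull (compl x).
Proof. by move=> hx; exact: hull_difference (oplus_compl x) hx hull_eone. Qed.

Lemma hull_oplus x y z : oplus x y = Some z ->
  [/\ hull x -> hull y -> hull z, hull x -> hull z -> hull y &
      hull y -> hull z -> hull x].
Proof.
move=> xy; split; last 2 first.
- exact: hull_difference.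
- by apply: hull_difference; rewrite oplusC.
(* Sums reduce to differences: [y + z' = x'], so [z'] is the difference of [x'] and [y]. *)
move=> hx hy; rewrite -(complK z).
have [t yt /oplus_complP tx] := oplus_assocr xy (oplus_compl z).
by subst t; apply/hull_compl/(hull_difference yt) => //; exact: hull_compl.
Qed.

Definition hull_sub_effect_algebra := SubEffectAlgebra hull_eone hull_oplus.

(** A decomposition of [v] is refined until [v1], [v2] and [u] are all partial sums of it; [u1] and
    [u2] collect the entries that [u] shares with [v1] and with [v2]. *)
Lemma hull_riesz_decomposition :
  riesz_decomposition (inherited hull_sub_effect_algebra).
Proof.
apply/inherited_riesz_decomposition => u v1 v2 v /= hu h1 h2 v12 uv.
have [Z [W [gZ sZ]]] : hull v by have [+ _ _] := hull_oplus v12; exact.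
have [X [Y [V [gX sX fZ _]]]] := hull_nested gZ sZ h1 (oplus_lel v12).
have sXY : lsum (X ++ Y) = Some v by rewrite (fine_lsum fZ).
have [y sY v1y] := lsum_cat_SomeP sX sXY.
have ? := oplus_cancel v1y v12; subst y.
rewrite catA in gX; have [A [B [V' [gA sA fXY _]]]] := hull_nested gX sXY hu uv.
have [X1 [Y1 [p f1 f2]]] := fine_catP fXY.
have [a [b [k [l [qA qB qX qY]]]]] := perm_cat_refine p.
have := sA; rewrite (perm_lsum qA) => /lsum_catP[u1 [u2 [s1 s2 u12]]].
exists u1, u2; split=> //.
- exists a, (b ++ B ++ V'); split=> //.
  apply: good_perm gA; rewrite (perm_trans (perm_cat qA (perm_refl _))) //.
  solve_perm.
- exists b, (a ++ B ++ V'); split=> //.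
  apply: good_perm gA; rewrite (perm_trans (perm_cat qA (perm_refl _))) //.
  solve_perm.
- have := fine_lsum f1; rewrite sX (perm_lsum qX) => /(lsum_cat_SomeP s1)[r _].
  exact: oplus_lel.
- have := fine_lsum f2; rewrite sY (perm_lsum qY) => /(lsum_cat_SomeP s2)[r _].
  exact: oplus_lel.
Qed.

(** A single split of [c] in the decomposition of 1 into [c] and [compl c]. *)
Lemma hull_hypermeager c y : sub_set Q c -> y <= c -> y <= compl c -> hull y.
Proof.
move=> Qc /ea_leP[z yz] yc'; exists [:: y], [:: z; compl c].
rewrite lsum1; split=> //.
exists [:: c; compl c]; rewrite lsum_cons lsum1 /= oplus_compl; split=> //.
  by move=> d; rewrite !inE => /orP[] /eqP -> //; exact: sub_compl.
exact: split_step.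
Qed.

End Hull.

(** * Blocks and their lattice structure *)

Lemma block_hypermeager (E : effectAlgebra) (Q : subEffectAlgebra E) :
  homogeneous E -> block Q ->
  forall c y : E, sub_set Q c -> y <= c -> y <= compl c -> sub_set Q y.
Proof.
move=> homE [rdpQ maxQ] c y Qc yc yc'.
have hullQ := maxQ _ (@hull_riesz_decomposition E Q homE rdpQ) (@hull_sub E Q).
exact/hullQ/(hull_hypermeager Qc yc yc').
Qed.

(** Complementation reverses the order, so the complement of an infimum of the complements is a
    supremum. *)
Lemma lattice_of_infimums (E : effectAlgebra) :
  (forall x y : E, infimums [set x; y] !=set0) -> is_lattice E.
Proof.
move=> inf x y; split=> //; have [w [wlb wglb]] := inf (compl x) (compl y).
exists (compl w); split.
- move=> z [] ->; rewrite le_compl_sym; apply: wlb; by [left|right].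
- move=> u uub; rewrite -[u]complK; apply/le_compl/wglb => z [] ->;
    apply/le_compl/uub; by [left|right].
Qed.

Theorem proposition3p15 (E : effectAlgebra)
  (E_orthocomplete : orthocomplete E) (E_homogeneous : homogeneous E)
  (Q : subEffectAlgebra E) (Q_block : block Q) :
  is_lattice (inherited Q).
Proof.
have rdp := Q_block.1.
apply: lattice_of_infimums => x y.
(* The Riesz property for [x <= y + y'] gives [x = p + q] with [p <= y] and [q <= y']; [r] is the
   difference of [y] and [p]. *)
have [p [q [/ea_leP[r pr] qy' pq]]] := rdp _ _ _ _ (oplus_compl y) (lee1 x).
rewrite oplusC in pq.
(* [q <= y' <= r'], so that every common lower bound [t] of [q] and [r] in [E]
   satisfies [t <= r <= q' <= t'] and hence lies in [Q]. *)
have rq' : r <= compl q.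
  by rewrite le_compl_sym (le_trans qy') // le_compl // (oplus_ler pr).
have [t [tq tr tmax]] := maximal_lbound E_orthocomplete (val q) (val r).
have Qt : sub_set Q t.
  apply: (block_hypermeager E_homogeneous Q_block (sub_valP r)) => //.
  rewrite le_compl_sym (le_trans _ (le_compl tq)) //.
  by move: rq'; rewrite inherited_le.
pose tQ : inherited Q := Sub t (mem_set Qt).
have tqQ : tQ <= q by rewrite inherited_le.
have trQ : tQ <= r by rewrite inherited_le.
have [w tw wx] := oplus_mono tqQ pq.
have := oplus_mono trQ; rewrite oplusC in pr; move=> /(_ _ _ pr)[w' tw' wy].
move: tw'; rewrite tw => -[?]; subst w'.
exists w; split; first by move=> z [] ->.
move=> z zlb; apply: (riesz_maximal_lbound rdp wx wy); last 2 first.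
- by apply: zlb; left.
- by apply: zlb; right.
(* A common lower bound [z] above [w = p + t] is [p + f] with [t <= f]; cancelling [p] gives
   [f <= q] and [f <= r], so [f = t] by maximality in [E]. *)
move=> {zlb}z /ea_leP[e we] zx zy; rewrite oplusC in tw.
have [f te pf] := oplus_assocr tw we.
rewrite oplusC in pq; rewrite oplusC in pr.
have fq := oplus_le_cancel pf pq zx; have fr := oplus_le_cancel pf pr zy.
rewrite !inherited_le in fq fr.
have ft : f = tQ.
  apply: val_inj; rewrite SubK; apply: tmax => //.
  by have := oplus_lel te; rewrite inherited_le SubK.
by move: pf; rewrite ft tw => -[].
Qed.
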